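(* Let $(W',I)$ and $(\widetilde W,\widetilde J)$ be Coxeter systems and let $\theta\colon W'\to \mathrm{Aut}(\widetilde W,\widetilde J)$ be a group homomorphism. Let $W=\widetilde W\rtimes W'$ be the corresponding semidirect product, with $W'$ and $\widetilde W$ regarded as subgroups of $W$ in the usual way, so that $w'\widetilde w w'^{-1}=\theta(w')(\widetilde w)$ for $w'\in W'$, $\widetilde w\in\widetilde W$. Fix a set $J$ of $W'$-orbit representatives on $\widetilde J$ and set $S:=I\cup J\subseteq W$. For $s\in S$ let $s^\perp:=\{r\in S : rs=sr\}$. Then $(W,S)$ is a Coxeter system if and only if conditions (1) and (2) below both hold: (1) for all $r,s\in J$ and $u\in W'$ with $r=usu^{-1}$, one has $r=s$ and $u\in W'_{I\cap r^\perp}$; (2) for all $r\in J$ and $s\in\widetilde J$ with $r\neq s$ and $rs$ of finite order, either (i) or (ii) holds: (i) $s=utu^{-1}$ for some $u\in W'_{I\cap r^\perp}$ and $t\in J$ with $t\ne r$ and $rt$ of finite order; (ii) $s=uvrvu^{-1}$ for some $u\in W'_{I\cap r^\perp}$ and $v\in I$ with $rv$ of finite order greater than $2$.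
   Context: $\mathrm{Aut}(\widetilde W,\widetilde J)$ denotes the group of automorphisms of the Coxeter system $(\widetilde W,\widetilde J)$, i.e. group automorphisms of $\widetilde W$ which map $\widetilde J$ onto itself. Through $\theta$ the group $W'$ acts on $\widetilde W$ and on the set $\widetilde J$; a set $J$ of orbit representatives contains exactly one element of each $W'$-orbit on $\widetilde J$. For $K\subseteq I$, $W'_K$ denotes the subgroup of $W'$ generated by $K$. *)

(* Defs.v *)
From HB Require Import structures.
From mathcomp Require Import all_boot.
From mathcomp Require Import boolp classical_sets.

Set Implicit Arguments.
Unset Strict Implicit.
Unset Printing Implicit Defensive.

Local Open Scope classical_set_scope.
Local Open Scope group_scope.

Section Groups.
Variable G : groupType.
Implicit Types (x s t : G) (S : set G).

Definition gen_subgroup S : set G :=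
  smallest (fun H : set G => group_closed [in H]) S.

Definition has_order x (n : nat) : Prop :=
  [/\ (0 < n)%N, x ^+ n = 1 & forall m : nat, (0 < m)%N -> x ^+ m = 1 -> (n <= m)%N].

Definition finite_order x : Prop := exists n : nat, has_order x n.

(* The presentation of G by S with relations (st)^m(s,t) = 1, for m(s,t) the
   order of st when finite, is expressed by its universal property; uniqueness
   of phi follows from generation. Only the values of f on S matter. *)
Definition coxeter_system S : Prop :=
  [/\ forall s, S s -> has_order s 2,
      gen_subgroup S = [set: G] &
      forall (H : groupType) (f : G -> H),
        (forall s t (n : nat), S s -> S t -> has_order (s * t) n ->
           (f s * f t) ^+ n = 1) ->
        exists phi : {multiplicative G -> H}, forall s, S s -> phi s = f s].

Definition perp S s : set G := [set r | S r /\ r * s = s * r].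

End Groups.

Record coxeter_aut (G : groupType) (S : set G) := CoxeterAut {
  coxeter_aut_fun :> G -> G;
  coxeter_autM : {morph coxeter_aut_fun : x y / x * y};
  coxeter_aut_bij : bijective coxeter_aut_fun;
  coxeter_aut_gens : coxeter_aut_fun @` S = S }.

Section CoxeterAutGroup.
Variables (G : groupType) (S : set G).
Local Notation A := (coxeter_aut S).

Lemma coxeter_aut_ext (a b : A) : a =1 b -> a = b.
Proof.
case: a b => f fM fB fS [g gM gB gS] /= /funext fg.
by subst g; congr CoxeterAut; apply: Prop_irrelevance.
Qed.

Definition coxeter_aut_one : A :=
  @CoxeterAut G S id (fun _ _ => erefl) (Bijective (frefl _) (frefl _))
    (image_id S).

Lemma coxeter_aut_mulM (a b : A) : {morph a \o b : x y / x * y}.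
Proof. by move=> x y /=; rewrite !coxeter_autM. Qed.

Lemma coxeter_aut_mul_gens (a b : A) : (a \o b) @` S = S.
Proof. by rewrite -image_comp !coxeter_aut_gens. Qed.

Definition coxeter_aut_mul (a b : A) : A :=
  CoxeterAut (coxeter_aut_mulM a b)
    (bij_comp (coxeter_aut_bij a) (coxeter_aut_bij b))
    (coxeter_aut_mul_gens a b).

Lemma coxeter_aut_inv_exists (a : A) : exists b : A, cancel a b.
Proof.
have [g ag ga] := coxeter_aut_bij a.
have gM : {morph g : x y / x * y}.
  by move=> x y; rewrite -{1}[x]ga -{1}[y]ga -coxeter_autM ag.
have gS : g @` S = S.
  rewrite -{1}(coxeter_aut_gens a) image_comp.
  by rewrite (_ : g \o a = id) ?image_id //; apply: funext.
by exists (CoxeterAut gM (Bijective ga ag) gS).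
Qed.

Definition coxeter_aut_inv (a : A) : A := sval (cid (coxeter_aut_inv_exists a)).

Lemma coxeter_aut_mulA : associative coxeter_aut_mul.
Proof. by move=> a b c; apply: coxeter_aut_ext. Qed.

Lemma coxeter_aut_mul1 : left_id coxeter_aut_one coxeter_aut_mul.
Proof. by move=> a; apply: coxeter_aut_ext. Qed.

Lemma coxeter_aut_mulr1 : right_id coxeter_aut_one coxeter_aut_mul.
Proof. by move=> a; apply: coxeter_aut_ext. Qed.

Lemma coxeter_aut_mulV :
  left_inverse coxeter_aut_one coxeter_aut_inv coxeter_aut_mul.
Proof.
move=> a; apply: coxeter_aut_ext => x /=.
exact: (svalP (cid (coxeter_aut_inv_exists a))).
Qed.

Lemma coxeter_aut_mulrV :
  right_inverse coxeter_aut_one coxeter_aut_inv coxeter_aut_mul.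
Proof.
move=> a; apply: coxeter_aut_ext => x /=.
apply: (bij_inj (coxeter_aut_bij (coxeter_aut_inv a))).
exact: (svalP (cid (coxeter_aut_inv_exists a))).
Qed.

HB.instance Definition _ := gen_eqMixin A.
HB.instance Definition _ := gen_choiceMixin A.
HB.instance Definition _ := isGroup.Build A coxeter_aut_mulA
  coxeter_aut_mul1 coxeter_aut_mulr1 coxeter_aut_mulV coxeter_aut_mulrV.

End CoxeterAutGroup.

(* The pair (x, u) stands for the product x u; theta is a phantom argument,
   recording which group structure the pairs carry. *)
Definition sdprod (Wt Wp : groupType) (Jt : set Wt)
  (theta : {multiplicative Wp -> coxeter_aut Jt}) : Type := (Wt * Wp)%type.

Section SemidirectProduct.
Variables (Wt Wp : groupType) (Jt : set Wt).
Variable theta : {multiplicative Wp -> coxeter_aut Jt}.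
Implicit Types (x : Wt) (u : Wp).

Local Notation sdp := (sdprod theta).
Implicit Types a b c : sdp.

Definition sdprod_one : sdp := (1, 1).
Definition sdprod_mul a b : sdp := (a.1 * theta a.2 b.1, a.2 * b.2).
Definition sdprod_inv a : sdp := (theta a.2^-1 a.1^-1, a.2^-1).

Lemma coxeter_aut1 (f : coxeter_aut Jt) : f 1 = 1.
Proof. by apply: (@mulgI _ (f 1)); rewrite -coxeter_autM !mulg1. Qed.

Lemma theta1 x : theta 1 x = x.
Proof.
apply: (bij_inj (coxeter_aut_bij (theta 1))).
by rewrite -[LHS]/((theta 1 * theta 1) x) -gmulfM mulg1.
Qed.

Lemma thetaM u v x : theta (u * v) x = theta u (theta v x).
Proof. by rewrite gmulfM. Qed.

Lemma sdprod_mulA : associative sdprod_mul.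
Proof.
by move=> a b c; rewrite /sdprod_mul /= coxeter_autM thetaM !mulgA.
Qed.

Lemma sdprod_mul1 : left_id sdprod_one sdprod_mul.
Proof. by case=> x u; rewrite /sdprod_mul /= theta1 !mul1g. Qed.

Lemma sdprod_mulr1 : right_id sdprod_one sdprod_mul.
Proof. by case=> x u; rewrite /sdprod_mul /= coxeter_aut1 !mulg1. Qed.

Lemma sdprod_mulV : left_inverse sdprod_one sdprod_inv sdprod_mul.
Proof.
case=> x u; rewrite /sdprod_mul /= -coxeter_autM.
by rewrite !mulVg coxeter_aut1.
Qed.

Lemma sdprod_mulrV : right_inverse sdprod_one sdprod_inv sdprod_mul.
Proof.
by case=> x u; rewrite /sdprod_mul /= -thetaM !mulgV theta1 mulgV.
Qed.

HB.instance Definition _ := gen_eqMixin sdp.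
HB.instance Definition _ := gen_choiceMixin sdp.
HB.instance Definition _ := isGroup.Build sdp sdprod_mulA
  sdprod_mul1 sdprod_mulr1 sdprod_mulV sdprod_mulrV.

Definition sdl x : sdp := (x, 1).
Definition sdr u : sdp := (1, u).

Lemma sdlM : {morph sdl : x y / x * y}.
Proof. by move=> x y; congr pair; rewrite /= ?theta1 ?mulg1. Qed.

Lemma sdrM : {morph sdr : u v / u * v}.
Proof. by move=> u v; congr pair; rewrite /= ?coxeter_aut1 ?mulg1. Qed.

HB.instance Definition _ := isMultiplicative.Build Wt sdp sdl sdlM.
HB.instance Definition _ := isMultiplicative.Build Wp sdp sdr sdrM.

Lemma sdprodE (a : sdp) : a = sdl a.1 * sdr a.2.
Proof.
by case: a => x u; congr pair; rewrite /= ?theta1 ?mulg1 ?mul1g.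
Qed.

Lemma sdprod_conj u x : sdr u * sdl x * (sdr u)^-1 = sdl (theta u x).
Proof.
apply: (canLR (mulgK _)); congr pair; rewrite /= ?mul1g ?mulg1 //.
by rewrite coxeter_aut1 mulg1.
Qed.

Definition orbit_representatives (J : set Wt) : Prop :=
  J `<=` Jt /\
  forall s, Jt s -> exists! r, J r /\ exists u, theta u s = r.

End SemidirectProduct.

(* Main.v *)
Require Import Defs.
From HB Require Import structures.
From mathcomp Require Import all_boot all_order all_algebra algC cyclotomic.
From mathcomp Require Import ring.
From mathcomp Require Import boolp classical_sets.

(** Write W for the semidirect product and P r for the subgroup of Wp
generated by the elements of I that commute with r.

Sufficiency of (1) and (2) is a presentation argument. Given images f s of the
elements of S that satisfy the Coxeter relations, the presentation of Wp
extends f on I to a morphism phi. Every element of Jt is a conjugate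
u r u^-1 with u in Wp and r in J, and its image must be
phi(u) f(r) phi(u)^-1; by (1) this does not depend on the choice of u, because
phi (P r) commutes with f r. By (2), up to conjugation every finite-order
relation between two elements of Jt is a relation between two elements of J,
or the relation on the square of a product r v with v in I. Hence the
presentation of Wt yields a morphism psi on Wt, which is Wp-equivariant, and
x u |-> psi(x) phi(u) is the required morphism (extend_W).

Necessity is proved without any theory of lengths, roots or parabolic
subgroups of W. Conditions (1) and (2) say that the only coincidences
u r u^-1 = r, and the only finite orders of products of two such conjugates,
are those forced by the relations between the elements of S. It therefore
suffices to map W to a group in which nothing else happens. The pairs
(r, u P r) stand for the conjugates u r u^-1; the matrix
cox_matrix records the order of the product of two of them when a relation of
W forces this order to be finite, and infinity otherwise. The Tits
representation of this Coxeter matrix, on the functions from pairs to complex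
algebraic numbers, has one reflection for each pair; Wp acts as well, by
permuting the pairs. The Coxeter relations of (W, S) hold for these
transformations (reflection_representation), so W maps to the group that they
generate, with u r u^-1 going to the reflection of (r, u P r). Distinct pairs
have distinct reflections, which gives (1) (conjugate_in_J), and two
reflections whose matrix entry is infinite have a product of infinite order,
which gives (2) (finite_order_conjugate). *)

Set Implicit Arguments.
Unset Strict Implicit.
Unset Printing Implicit Defensive.

Local Open Scope classical_set_scope.
Local Open Scope group_scope.

(** * The numbers 2 cos (pi / m) *)

Section HalfAngleRoot.
Import GRing.Theory Num.Theory.
Local Open Scope ring_scope.

(** For m > 0 this plays the role of exp (i pi / m). The value 0 of m encodes an
infinite order, with limit value exp 0 = 1. *)
Definition half_root (m : nat) : algC :=
  if m is k.+1 then sval (@C_prim_root_exists k.+1.*2 isT) else 1.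

(** Any primitive root of unity of order 2m serves here: for m > 0, two_cos m is
a Galois conjugate of 2 cos (pi / m). *)
Definition two_cos (m : nat) : algC := half_root m + (half_root m)^-1.

Lemma half_root_prim m : (0 < m)%N -> m.*2.-primitive_root (half_root m).
Proof. by case: m => // k _; exact: (svalP (C_prim_root_exists _)). Qed.

Lemma half_root_neq0 m : half_root m != 0.
Proof.
case: m => [|m]; first exact: oner_neq0.
apply/eqP => w0; have := prim_expr_order (half_root_prim (ltn0Sn m)).
by rewrite w0 expr0n => /eqP; rewrite eq_sym oner_eq0.
Qed.

Lemma two_cos0 : two_cos 0 = 2.
Proof. by rewrite /two_cos /= invr1. Qed.

Lemma two_cos1 : two_cos 1 = - 2.
Proof.
have pr := half_root_prim (ltn0Sn 0).
have /eqP : half_root 1 ^+ 2 = 1 := prim_expr_order pr.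
rewrite /two_cos sqrf_eq1 => /orP[/eqP w1|/eqP ->].
  by have := eq_prim_root_expr pr 1 0; rewrite expr1 expr0 w1 eqxx.
rewrite invrN1; ring.
Qed.

Lemma sum_root_eq0 (z : algC) m :
  z != 1 -> z ^+ m = 1 -> \sum_(i < m) z ^+ i = 0.
Proof.
move=> z1 zm; apply: (mulfI (x := z - 1)); first by rewrite subr_eq0.
by rewrite -subrX1 zm subrr mulr0.
Qed.

End HalfAngleRoot.

(** * The contragredient Tits representation of a Coxeter matrix *)

Section Reflections.
Import GRing.Theory Num.Theory.
Local Open Scope ring_scope.

Variables (X : Type) (M : X -> X -> nat).
Hypotheses (Mxx : forall x, M x x = 1%N) (MC : forall x y, M x y = M y x).
Implicit Types (x y z : X) (h : X -> algC).

(** A function h on X is a linear form on the space with basis X, and reflection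
x is the dual of e_z |-> e_z - 2 B(e_x, e_z) e_x with
B(e_x, e_z) = - cos (pi / M x z). The dual side needs no finite supports. *)
Definition reflection x h : X -> algC := fun z => h z + two_cos (M x z) * h x.

Lemma reflection_self x h : reflection x h x = - h x.
Proof. by rewrite /reflection Mxx two_cos1; ring. Qed.

Lemma reflectionK x : involutive (reflection x).
Proof.
move=> h; apply: funext => z.
by rewrite {1}/reflection reflection_self /reflection; ring.
Qed.

Lemma reflection_inj x y : reflection x = reflection y -> x = y.
Proof.
move=> eq_xy; apply: contrapT => neq_xy.
have := congr1 (fun f => f (fun z => if `[< z = x >] then 1 else 0) x) eq_xy.
rewrite /= reflection_self /reflection.
rewrite asboolT // (asboolF (P := y = x)); last by move/esym.
rewrite mulr0 addr0 => /eqP; rewrite eq_sym -subr_eq0 opprK.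
by rewrite (_ : 1 + 1 = 2%:R) ?pnatr_eq0.
Qed.

Section TwoReflections.
Variables x y : X.
Definition rotation h := reflection x (reflection y h).
Local Notation rot := rotation.
Local Notation c := (two_cos (M x y)).

Lemma rotationE h z : rot h z =
  h z + two_cos (M y z) * h y + two_cos (M x z) * (h x + c * h y).
Proof. by rewrite /rotation /reflection (MC y x). Qed.

(** A rotation changes h only through its values at x and y, so its iterates are
controlled by the sums of these two values along the orbit of h. *)
Lemma rotation_iter n h z :
  iter n rot h z = h z + two_cos (M y z) * (\sum_(i < n) iter i rot h y)
    + two_cos (M x z) *
      (\sum_(i < n) iter i rot h x + c * (\sum_(i < n) iter i rot h y)).
Proof.
elim: n => [|n IHn]; first by rewrite !big_ord0 !(mulr0, addr0).
rewrite iterS rotationE !big_ord_recr /= !IHn; ring.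
Qed.

(** The plane of pairs (h x, h y) carries the rotation by twice the angle of w:
the form h x + w h y is an eigenform, and so is the one given by w^-1. *)
Lemma rotation_eigen (w : algC) h : w != 0 -> c = w + w^-1 ->
  rot h x + w * rot h y = w ^+ 2 * (h x + w * h y).
Proof.
move=> w0 cw; rewrite !rotationE !Mxx two_cos1 (MC y x) cw.
by field.
Qed.

Lemma rotation_iter_eigen (w : algC) n h : w != 0 -> c = w + w^-1 ->
  iter n rot h x + w * iter n rot h y = (w ^+ 2) ^+ n * (h x + w * h y).
Proof.
move=> w0 cw; elim: n => [|n IHn]; first by rewrite expr0 mul1r.
by rewrite iterS rotation_eigen // IHn mulrA -exprS.
Qed.

Lemma rotation_sum_eq0 (w : algC) h : w != 0 -> c = w + w^-1 ->
    w ^+ 2 != 1 -> (w ^+ 2) ^+ M x y = 1 ->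
  \sum_(i < M x y) iter i rot h x + w * \sum_(i < M x y) iter i rot h y = 0.
Proof.
move=> w0 cw w2 wM; rewrite mulr_sumr -big_split /=.
under eq_bigr do rewrite rotation_iter_eigen //.
by rewrite -mulr_suml sum_root_eq0 ?mul0r.
Qed.

(** With w = half_root (M x y), the sums of both eigenforms along the orbit
vanish, and the two forms are independent since w ^+ 2 != 1. Hence the sums
in rotation_iter vanish. *)
Lemma reflection_order h : M x y <> 1%N -> iter (M x y) rot h = h.
Proof.
move=> M1; apply: funext => z; rewrite rotation_iter.
have [->|M0] := posnP (M x y); first by rewrite !big_ord0 !(mulr0, addr0).
have M2 : (1 < M x y)%N by case: (M x y) M0 M1 => [|[]].
set w := half_root (M x y).
have pr : (M x y).*2.-primitive_root w := half_root_prim M0.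
have w0 : w != 0 := half_root_neq0 _.
have w2 : w ^+ 2 != 1.
  rewrite -(prim_order_dvd pr); apply/negP => /dvdn_leq - /(_ isT).
  by rewrite (leq_double _ 1) leqNgt M2.
have wM : (w ^+ 2) ^+ M x y = 1 by rewrite -exprM mul2n prim_expr_order.
have sum_w := rotation_sum_eq0 h w0 erefl w2 wM.
have sum_V : \sum_(i < M x y) iter i rot h x
               + w^-1 * \sum_(i < M x y) iter i rot h y = 0.
  apply: rotation_sum_eq0; rewrite ?invr_eq0 ?exprVn ?invr_eq1 //.
    by rewrite invrK addrC.
  by rewrite wM invr1.
have sum_y : \sum_(i < M x y) iter i rot h y = 0.
  have /eqP : (w ^+ 2 - 1) * \sum_(i < M x y) iter i rot h y = 0.
    transitivity (w * (\sum_(i < M x y) iter i rot h x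
                         + w * \sum_(i < M x y) iter i rot h y
                       - (\sum_(i < M x y) iter i rot h x
                         + w^-1 * \sum_(i < M x y) iter i rot h y))).
      by field.
    by rewrite sum_w sum_V subrr mulr0.
  by rewrite mulf_eq0 subr_eq0 (negbTE w2) => /eqP.
move: sum_w; rewrite sum_y mulr0 addr0 => ->.
by rewrite !(mulr0, addr0).
Qed.

(** For the infinite order, w = 1 and h x + h y is invariant: the action on the
plane is unipotent, and each step subtracts 2 (h x + h y) from h x. *)
Lemma reflection_order_inf n : M x y = 0%N -> (0 < n)%N ->
  exists h, iter n rot h <> h.
Proof.
move=> M0 n0; pose h z : algC := if `[< z = x >] then 1 else 0.
have neq_yx : y <> x by move=> yx; move: M0; rewrite yx Mxx.
have hx : h x = 1 by rewrite /h asboolT.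
have hy : h y = 0 by rewrite /h asboolF.
have c2 : c = 2 by rewrite M0 two_cos0.
exists h => /(congr1 (fun h' => h' x)).
suff -> : iter n rot h x = 1 - 2 * n%:R.
  rewrite hx => /eqP; rewrite -subr_eq0 addrAC subrr sub0r oppr_eq0.
  by rewrite mulf_eq0 !pnatr_eq0 /= -leqn0 leqNgt n0.
elim: n {n0} => [|n IHn]; first by rewrite /= hx; ring.
have c1 : c = 1 + 1^-1 :> algC by rewrite c2 invr1.
have := rotation_iter_eigen n h (oner_neq0 _) c1.
rewrite expr1n expr1n !mul1r hx hy addr0 IHn => sum1.
rewrite iterS rotationE Mxx two_cos1 (MC y x) c2 IHn.
have -> : iter n rot h y = 2 * n%:R.
  by apply: (addrI (1 - 2 * n%:R)); rewrite sum1; ring.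
by rewrite -natr1; ring.
Qed.

End TwoReflections.
End Reflections.

(** * Group morphisms, generated subgroups and orders *)

Section Homomorphisms.
Variables (G H : groupType) (f : {multiplicative G -> H}).

Lemma hom1 : f 1 = 1.
Proof. by apply: (mulgI (f 1)); rewrite -gmulfM !mulg1. Qed.

Lemma homV x : f x^-1 = (f x)^-1.
Proof. by apply/esym/mulg1_eq; rewrite -gmulfM mulgV hom1. Qed.

Lemma homX n x : f (x ^+ n) = f x ^+ n.
Proof. by elim: n => [|n IHn]; rewrite ?hom1 // !expgS gmulfM IHn. Qed.

End Homomorphisms.

Section GeneratedSubgroups.
Variable G : groupType.
Implicit Types (S : set G) (Q : G -> Prop).

Lemma gen_subgroup_closed S : group_closed [in gen_subgroup S].
Proof.
split; first by rewrite inE => H [] [+ _] _; rewrite inE.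
move=> x y; rewrite !inE => Sx Sy H [Hcl HS].
have := Hcl.2 x y; rewrite !inE; apply; [exact: Sx|exact: Sy].
Qed.

Lemma gen_subgroup1 S : gen_subgroup S 1.
Proof. by have [+ _] := gen_subgroup_closed S; rewrite inE. Qed.

Lemma gen_subgroupM S x y :
  gen_subgroup S x -> gen_subgroup S y -> gen_subgroup S (x * y).
Proof.
move=> Sx Sy; have /(_ x y) := group_closedM (gen_subgroup_closed S).
by rewrite !inE; apply.
Qed.

Lemma gen_subgroupV S x : gen_subgroup S x -> gen_subgroup S x^-1.
Proof.
move=> Sx; have /(_ x) := group_closedV (gen_subgroup_closed S).
by rewrite !inE; apply.
Qed.

Lemma sub_gen_subgroup S : S `<=` gen_subgroup S.
Proof. exact: sub_gen_smallest. Qed.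

Lemma gen_subgroup_ind S Q :
  Q 1 -> (forall x y, Q x -> Q y -> Q (x * y^-1)) -> (forall s, S s -> Q s) ->
  forall x, gen_subgroup S x -> Q x.
Proof.
move=> Q1 QM QS x Sx; apply: (Sx [set y | Q y]); split=> //.
by split=> [|y z]; rewrite !inE //; apply: QM.
Qed.

Lemma eq_on_gen (H : groupType) (f g : G -> H) S :
    {morph f : x y / x * y} -> {morph g : x y / x * y} ->
    (forall s, S s -> f s = g s) ->
  forall x, gen_subgroup S x -> f x = g x.
Proof.
move=> fM gM fgS.
pose f' : {multiplicative G -> H} :=
  HB.pack f (isMultiplicative.Build _ _ f fM).
pose g' : {multiplicative G -> H} :=
  HB.pack g (isMultiplicative.Build _ _ g gM).
apply: gen_subgroup_ind => // [|x y fgx fgy].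
  exact: etrans (hom1 f') (esym (hom1 g')).
rewrite fM gM fgx; congr (_ * _).
by rewrite [LHS](homV f') [RHS](homV g') /= fgy.
Qed.

End GeneratedSubgroups.

Section Orders.
Implicit Types G H : groupType.

Lemma conj_expg G (a x : G) n : a * x ^+ n * a^-1 = (a * x * a^-1) ^+ n.
Proof.
have conjE y : a * y * a^-1 = y ^ a^-1 by rewrite conjgE invgK mulgA.
by rewrite !conjE conjXg.
Qed.

Lemma conj_mulg G (a x y : G) :
  a * (x * y) * a^-1 = (a * x * a^-1) * (a * y * a^-1).
Proof. by rewrite !gnorm. Qed.

Lemma has_order_unique G (x : G) m n : has_order x m -> has_order x n -> m = n.
Proof.
case=> m0 xm mmin [n0 xn nmin].
by apply/eqP; rewrite eqn_leq mmin // nmin.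
Qed.

Lemma has_order1 G (x : G) : has_order x 1 <-> x = 1.
Proof. by split=> [[]|->] //; split. Qed.

Lemma has_order_iff G H (x : G) (y : H) n :
  (forall m, x ^+ m = 1 <-> y ^+ m = 1) -> has_order x n <-> has_order y n.
Proof.
move=> xy; split=> -[n0 xn nmin]; split=> //; try exact/xy.
  by move=> m m0 /xy; apply: nmin.
by move=> m m0 /xy; apply: nmin.
Qed.

Lemma has_order_morph G H (f : {multiplicative G -> H}) x n :
  injective f -> has_order (f x) n <-> has_order x n.
Proof.
move=> f_inj; apply: has_order_iff => m; rewrite -homX.
by split=> [|->]; rewrite ?hom1 // -[RHS](hom1 f) => /f_inj.
Qed.

Lemma has_order_conj G (a x : G) n :
  has_order (a * x * a^-1) n <-> has_order x n.
Proof.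
apply: has_order_iff => m; rewrite -conj_expg.
split=> [/(canRL (mulgVK _))|->]; last by rewrite mulg1 mulgV.
by rewrite mul1g -{2}[a]mulg1 => /mulgI.
Qed.

Lemma has_order_mulC G (x y : G) n : has_order (x * y) n -> has_order (y * x) n.
Proof. by move/(has_order_conj y); rewrite mulgA mulgK. Qed.

Lemma expg_eq1_swap G (x y : G) n : (x * y) ^+ n = 1 -> (y * x) ^+ n = 1.
Proof.
by move=> xyn; rewrite -[y * x](mulgK y) -(mulgA y) -conj_expg xyn mulg1 mulgV.
Qed.

Lemma has_order_dvdn G (x : G) n m : has_order x n -> x ^+ m = 1 -> (n %| m)%N.
Proof.
case=> n0 xn nmin xm; rewrite /dvdn; apply: contraT; rewrite -lt0n => r0.
suff /nmin - /(_ r0) : x ^+ (m %% n) = 1 by rewrite leqNgt ltn_pmod.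
by move: xm; rewrite {1}(divn_eq m n) expgnDr mulnC expgnA xn expg1n mul1g.
Qed.

Lemma expg_dvdn G (x : G) n m : x ^+ n = 1 -> (n %| m)%N -> x ^+ m = 1.
Proof. by move=> xn /dvdnP[k ->]; rewrite mulnC expgnA xn expg1n. Qed.

Lemma has_order_double G (x : G) k : has_order x k.*2 -> has_order (x * x) k.
Proof.
rewrite -expg2 => -[k0 xk kmin]; split=> [||m m0].
- by rewrite -double_gt0.
- by rewrite -expgnA mul2n.
by rewrite -expgnA mul2n -leq_double => /kmin -> //; rewrite double_gt0.
Qed.

Lemma ex_has_order G (x : G) n : (0 < n)%N -> x ^+ n = 1 -> finite_order x.
Proof.
move=> n0 xn; have ex : exists m, (0 < m)%N && `[< x ^+ m = 1 >].
  by exists n; rewrite n0; apply/asboolP.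
exists (ex_minn ex); case: ex_minnP => m /andP[m0 /asboolP xm] mmin.
by split=> // l l0 xl; apply: mmin; rewrite l0; apply/asboolP.
Qed.

Lemma invg_order2 G (x : G) : has_order x 2 -> x^-1 = x.
Proof. by case=> _ xx _; apply: mulg1_eq. Qed.

Lemma mulg_order2 G (x : G) : has_order x 2 -> x * x = 1.
Proof. by case. Qed.

Lemma neq1_order2 G (x : G) : has_order x 2 -> x <> 1.
Proof. by move=> x2 x1; have := has_order_unique x2 ((has_order1 x).2 x1). Qed.

End Orders.

(** * The group of all permutations of a type *)

Section SymmetricGroup.
Variable V : Type.

Record sym_group := SymGroup {
  sym_fun :> V -> V;
  sym_inv : V -> V;
  sym_funK : cancel sym_fun sym_inv;
  sym_invK : cancel sym_inv sym_fun }.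

Implicit Types a b c : sym_group.

Lemma sym_ext a b : a =1 b -> a = b.
Proof.
case: a b => f f' fK f'K [g g' gK g'K] /= /funext fg; subst g.
have f'g' : f' = g' by apply: funext => v; rewrite -{1}[v]g'K fK.
by subst g'; congr SymGroup; apply: Prop_irrelevance.
Qed.

Definition sym_one : sym_group :=
  @SymGroup id id (fun _ => erefl) (fun _ => erefl).

Definition sym_mul a b : sym_group :=
  @SymGroup (a \o b) (sym_inv b \o sym_inv a)
    (can_comp (@sym_funK a) (@sym_funK b))
    (can_comp (@sym_invK b) (@sym_invK a)).

Definition sym_inverse a : sym_group := SymGroup (@sym_invK a) (@sym_funK a).

Lemma sym_mulA : associative sym_mul.
Proof. by move=> a b c; apply: sym_ext. Qed.
Lemma sym_mul1 : left_id sym_one sym_mul.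
Proof. by move=> a; apply: sym_ext. Qed.
Lemma sym_mulr1 : right_id sym_one sym_mul.
Proof. by move=> a; apply: sym_ext. Qed.
Lemma sym_mulV : left_inverse sym_one sym_inverse sym_mul.
Proof. by move=> a; apply: sym_ext => v; apply: sym_funK. Qed.
Lemma sym_mulrV : right_inverse sym_one sym_inverse sym_mul.
Proof. by move=> a; apply: sym_ext => v; apply: sym_invK. Qed.

HB.instance Definition _ := gen_eqMixin sym_group.
HB.instance Definition _ := gen_choiceMixin sym_group.
HB.instance Definition _ := isGroup.Build sym_group sym_mulA
  sym_mul1 sym_mulr1 sym_mulV sym_mulrV.

Lemma sym_expE a n v : (a ^+ n) v = iter n a v.
Proof. by elim: n v => // n IHn v; rewrite expgS /= -IHn. Qed.

End SymmetricGroup.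

(** * A representation of W when (W, S) is a Coxeter system *)

Section ReflectionRepresentation.
Variables (W Wp : groupType).
Variables (iota : {multiplicative Wp -> W}) (pr : {multiplicative W -> Wp}).
Variables (I : set Wp) (J : set W).
Hypothesis iotaK : cancel iota pr.
Hypothesis prJ : forall r, J r -> pr r = 1.
Hypothesis coxI : coxeter_system I.
Local Notation S := (iota @` I `|` J).
Local Notation P r := (gen_subgroup (I `&` iota @^-1` perp S r)).
Local Notation X := (W * set Wp)%type.
Implicit Types (x y z : X) (r s t : W) (u v : Wp).

Let I2 v : I v -> has_order v 2. Proof. by case: coxI => + _ _; apply. Qed.

Definition translate u x : X := (x.1, [set w | x.2 (u^-1 * w)]).

(** Stands for the conjugate of r by u. Since P r commutes with r, this conjugate
depends on u only through the coset u P r; condition (1) says that conversely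
it determines r and the coset. *)
Definition coset_point r u : X := translate u (r, P r).

(** Up to conjugation by Wp, the relations between two elements of J and between
one of J and one of I force finite orders for the products r t, with t in J,
and r (v r v^-1) = (r v)^2, with v in I. For x = (r, u P r) and
y = (t, u' P t) these are the two kinds of pairs of cosets selected here, and
linked_order x y is then the set whose only possible element is the order of
the product of the two conjugates. *)
Definition linked_order x y : set nat := [set n | exists a b,
  [/\ x.2 a, y.2 b, if x.1 == y.1 then I (a^-1 * b) else a = b &
      has_order (iota a * x.1 * (iota a)^-1 * (iota b * y.1 * (iota b)^-1)) n]].

(** For x <> y, the default 0, which stands for infinity, is taken when x and y
are not linked, and when they are but their product has infinite order. *)
Definition cox_matrix x y : nat :=
  if `[< x = y >] then 1%N else xget 0%N (linked_order x y).

Lemma translateM u v x : translate u (translate v x) = translate (u * v) x.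
Proof.
by congr pair; apply: funext => w /=; rewrite invgM mulgA.
Qed.

Lemma translate1 x : translate 1 x = x.
Proof.
by case: x => r A; congr pair; apply: funext => w /=; rewrite invg1 mul1g.
Qed.

Lemma translateK u : cancel (translate u) (translate u^-1).
Proof. by move=> x; rewrite translateM mulVg translate1. Qed.

Lemma translate_coset u r v :
  translate u (coset_point r v) = coset_point r (u * v).
Proof. exact: translateM. Qed.

Lemma linked_orderC x y : linked_order x y = linked_order y x.
Proof.
suff sub x' y' : linked_order x' y' `<=` linked_order y' x'.
  by apply/seteqP; split; apply: sub.
move=> n [a [b [xa yb link ord]]]; exists b, a; split=> //.
  move: link; rewrite eq_sym; case: ifP => // _ Iab.
  by have /invg_order2 := I2 Iab; rewrite invgM invgK => ->.
exact: has_order_mulC.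
Qed.

Lemma cox_matrixC x y : cox_matrix x y = cox_matrix y x.
Proof.
rewrite /cox_matrix linked_orderC; congr (if _ then _ else _).
by apply: asbool_equiv_eq; split=> ->.
Qed.

Lemma cox_matrixxx x : cox_matrix x x = 1%N.
Proof. by rewrite /cox_matrix asboolT. Qed.

Lemma linked_order_translate u x y :
  linked_order (translate u x) (translate u y) = linked_order x y.
Proof.
have conjE a r : iota (u * a) * r * (iota (u * a))^-1 =
    iota u * (iota a * r * (iota a)^-1) * (iota u)^-1.
  by rewrite gmulfM invgM !mulgA.
apply/seteqP; split=> n [a [b /= [xa yb link ord]]].
  exists (u^-1 * a), (u^-1 * b); split=> //; last first.
    by apply/(has_order_conj (iota u)); rewrite conj_mulg -!conjE !mulVKg.
  move: link; case: ifP => [_|_ -> //].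
  by rewrite invgM invgK mulgA mulgK.
exists (u * a), (u * b); split; rewrite /= ?mulKg //.
  move: link; case: ifP => [_|_ -> //].
  by rewrite invgM mulgA mulgVK.
by rewrite !conjE -conj_mulg; apply/has_order_conj.
Qed.

(** This invariance is what makes the action of Wp on functions conjugate
reflections to reflections. *)
Lemma cox_matrix_translate u x y :
  cox_matrix (translate u x) (translate u y) = cox_matrix x y.
Proof.
rewrite /cox_matrix linked_order_translate; congr (if _ then _ else _).
by apply: asbool_equiv_eq; split=> [/(can_inj (translateK u))|->].
Qed.

Local Notation Sym := (sym_group (X -> algC)).

Definition sym_reflection x : Sym :=
  SymGroup (reflectionK cox_matrixxx x) (reflectionK cox_matrixxx x).

Definition act_fun u (h : X -> algC) : X -> algC :=
  fun z => h (translate u^-1 z).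

Lemma act_funM u v h : act_fun u (act_fun v h) = act_fun (u * v) h.
Proof. by apply: funext => z; rewrite /act_fun translateM invgM. Qed.

Lemma act_fun1 h : act_fun 1 h = h.
Proof. by apply: funext => z; rewrite /act_fun invg1 translate1. Qed.

Lemma act_funK u : cancel (act_fun u) (act_fun u^-1).
Proof. by move=> h; rewrite act_funM mulVg act_fun1. Qed.

Lemma act_funVK u : cancel (act_fun u^-1) (act_fun u).
Proof. by move=> h; rewrite act_funM mulgV act_fun1. Qed.

Definition act u : Sym := SymGroup (act_funK u) (act_funVK u).

Lemma actM : {morph act : u v / u * v}.
Proof. by move=> u v; apply: sym_ext => h /=; rewrite act_funM. Qed.

HB.instance Definition _ := isMultiplicative.Build Wp Sym act actM.

Lemma act_reflection u x :
  act u * sym_reflection x * (act u)^-1 = sym_reflection (translate u x).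
Proof.
apply: (canLR (mulgK _)); apply: sym_ext => h; apply: funext => z /=.
rewrite /act_fun /reflection translateK.
by rewrite -(cox_matrix_translate u x) translateM mulgV translate1.
Qed.

Lemma sym_reflection_mulgg x : sym_reflection x * sym_reflection x = 1.
Proof. by apply: sym_ext => h /=; apply: reflectionK; apply: cox_matrixxx. Qed.

Lemma sym_reflection_inj : injective sym_reflection.
Proof.
move=> x y eq_xy; apply: (reflection_inj cox_matrixxx).
by rewrite -[LHS]/(sym_fun (sym_reflection x)) eq_xy.
Qed.

Lemma sym_reflection_order x y :
  cox_matrix x y <> 1%N ->
  (sym_reflection x * sym_reflection y) ^+ cox_matrix x y = 1.
Proof.
move=> M1; apply: sym_ext => h; rewrite sym_expE.
exact (reflection_order cox_matrixxx cox_matrixC _ M1).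
Qed.

Lemma iota_inj : injective iota. Proof. exact: can_inj iotaK. Qed.

Lemma perp_commute r u : P r u -> iota u * r = r * iota u.
Proof.
move: u; apply: gen_subgroup_ind; first by rewrite hom1 mul1g mulg1.
  move=> u v ur vr; rewrite gmulfM homV.
  apply: (commute_sym (commuteM (commute_sym ur) (commuteV (commute_sym vr)))).
by move=> v [_ [_]].
Qed.

Lemma conj_coset r u a : (coset_point r u).2 a ->
  iota a * r * (iota a)^-1 = iota u * r * (iota u)^-1.
Proof.
rewrite /= => /perp_commute ra; rewrite -[a](mulVKg u) gmulfM.
by rewrite -(mulgA (iota u)) ra invgM !mulgA mulgK.
Qed.

Lemma coset_point_mem r u : (coset_point r u).2 u.
Proof. by rewrite /= mulVg; apply: gen_subgroup1. Qed.

Lemma coset_point_inj r s u v :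
  coset_point r u = coset_point s v -> r = s /\ P r (u^-1 * v).
Proof.
move=> eq_rs; split; first by case: eq_rs.
have : (coset_point s v).2 v by exact: coset_point_mem.
by rewrite -eq_rs.
Qed.

Lemma coset_point1 r u : P r u -> coset_point r u = coset_point r 1.
Proof.
move=> Pu; congr pair; apply: funext => w /=; rewrite invg1 mul1g.
apply: propext; split=> Pw; last exact: gen_subgroupM (gen_subgroupV Pu) Pw.
by rewrite -[w](mulVKg u); apply: gen_subgroupM.
Qed.

Lemma linked_order_coset r t u v n :
  linked_order (coset_point r u) (coset_point t v) n ->
  has_order (iota u * r * (iota u)^-1 * (iota v * t * (iota v)^-1)) n.
Proof.
by case=> a [b [ra tb _]]; rewrite /= (conj_coset ra) (conj_coset tb).
Qed.

(** The order that links two cosets does not depend on the chosen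
representatives, so it is the entry of cox_matrix. *)
Lemma coset_point_relation r t u v n :
  let x := coset_point r u in let y := coset_point t v in
  linked_order x y n -> (n = 1%N -> x = y) ->
  (sym_reflection x * sym_reflection y) ^+ n = 1.
Proof.
move=> x y link n1; have [<-|neq_xy] := pselect (x = y).
  by rewrite sym_reflection_mulgg expg1n.
suff Mn : cox_matrix x y = n.
  by rewrite -{1}Mn; apply: sym_reflection_order; rewrite Mn => /n1.
rewrite /cox_matrix asboolF //; apply: xget_unique => // m link'.
exact: has_order_unique (linked_order_coset link') (linked_order_coset link).
Qed.

Hypothesis coxS : coxeter_system S.

Lemma order2J r : J r -> has_order r 2.
Proof. by case: coxS => + _ _ Jr; apply; right. Qed.

(** The projection pr is trivial on J and on no element of I, so it tells the
two kinds of generators apart. *)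
Definition gen_image w : Sym :=
  if pr w == 1 then sym_reflection (coset_point w 1) else act (pr w).

Lemma gen_imageJ r : J r -> gen_image r = sym_reflection (coset_point r 1).
Proof. by move=> Jr; rewrite /gen_image prJ // eqxx. Qed.

Lemma gen_imageI v : I v -> gen_image (iota v) = act v.
Proof.
by move=> /I2/neq1_order2/eqP v1; rewrite /gen_image iotaK (negbTE v1).
Qed.

(** Projecting to Wp shows that r v has even order 2k. Its square corresponds to
the product of the reflections of (r, P r) and (r, v P r), which are linked
with order k; when k = 1, v commutes with r and the two pairs coincide. *)
Lemma gen_image_IJ r v n : J r -> I v -> has_order (r * iota v) n ->
  (gen_image r * gen_image (iota v)) ^+ n = 1.
Proof.
move=> Jr Iv ord; rewrite gen_imageJ // gen_imageI //.
have v2 := I2 Iv; have r2 := order2J Jr.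
have /dvdnP[k nk] : (2 %| n)%N.
  case: ord => _ /(congr1 pr) + _; rewrite homX hom1 gmulfM iotaK prJ // mul1g.
  exact: has_order_dvdn.
rewrite {n}nk muln2 in ord *; have ordk := has_order_double ord.
have reflv : sym_reflection (coset_point r 1) * act v *
    (sym_reflection (coset_point r 1) * act v)
    = sym_reflection (coset_point r 1) * sym_reflection (coset_point r v).
  have actV : act v = (act v)^-1.
    by apply/esym/mulg1_eq; rewrite -gmulfM mulg_order2 ?hom1.
  rewrite {2}actV -!mulgA; congr (_ * _).
  by rewrite !mulgA act_reflection translate_coset mulg1.
have conj_r : iota 1 * r * (iota 1)^-1 * (iota v * r * (iota v)^-1)
    = r * iota v * (r * iota v).
  by rewrite hom1 mul1g invg1 mulg1 -homV (invg_order2 v2) !mulgA.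
rewrite -mul2n expgnA expg2 reflv; apply: coset_point_relation.
  exists 1, v; split; rewrite ?eqxx ?invg1 ?mul1g //.
  - exact: coset_point_mem.
  - exact: coset_point_mem.
  - by have := conj_r; rewrite hom1 mul1g invg1 => ->.
move=> k1; move: ordk; rewrite k1 => /has_order1 rvrv.
apply/esym/coset_point1; apply: sub_gen_subgroup; split=> //.
rewrite /preimage /perp /=; split; first by left; exists v.
by move/mulg1_eq: rvrv; rewrite invgM -homV (invg_order2 v2) (invg_order2 r2).
Qed.

Lemma gen_image_JJ r t n : J r -> J t -> has_order (r * t) n ->
  (gen_image r * gen_image t) ^+ n = 1.
Proof.
move=> Jr Jt ord; rewrite !gen_imageJ //.
have [rt|neq_rt] := eqVneq r t.
  by rewrite -rt sym_reflection_mulgg expg1n.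
apply: coset_point_relation.
  exists 1, 1; split; rewrite /= ?(negbTE neq_rt) //.
  - exact: coset_point_mem.
  - exact: coset_point_mem.
  - by rewrite hom1 !mul1g invg1 !mulg1.
move=> n1; move: ord; rewrite n1 => /has_order1/mulg1_eq.
by rewrite (invg_order2 (order2J Jr)) => /eqP; rewrite (negbTE neq_rt).
Qed.

Lemma reflection_representation : exists Phi : {multiplicative W -> Sym},
  (forall r, J r -> Phi r = sym_reflection (coset_point r 1)) /\
  (forall u, Phi (iota u) = act u).
Proof.
have [_ _ /(_ Sym gen_image) []] := coxS.
  move=> s t n [[u Iu <-]|Js] [[v Iv <-]|Jt] ord.
  - rewrite !gen_imageI // -gmulfM -homX.
    move: ord; rewrite -gmulfM => /(has_order_morph _ _ iota_inj)[_ -> _].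
    exact: hom1.
  - by apply/expg_eq1_swap/gen_image_IJ/has_order_mulC.
  - exact: gen_image_IJ.
  - exact: gen_image_JJ.
move=> Phi PhiS; exists Phi; split=> [r Jr|].
  by rewrite PhiS ?gen_imageJ //; right.
have genI u : gen_subgroup I u by case: coxI => _ -> _.
move=> u; apply: (eq_on_gen (f := Phi \o iota)) (genI u) => [x y|x y|v Iv] /=.
- by rewrite !gmulfM.
- exact: actM.
by rewrite PhiS ?gen_imageI //; left; exists v.
Qed.

(** Equal conjugates have equal images, hence equal pairs. *)
Lemma conjugate_in_J r s u : J r -> J s ->
  r = iota u * s * (iota u)^-1 -> r = s /\ P r u.
Proof.
have [Phi [PhiJ PhiI]] := reflection_representation.
move=> Jr Js /(congr1 Phi); rewrite !gmulfM homV !PhiI !PhiJ // act_reflection.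
rewrite translate_coset mulg1 => /sym_reflection_inj/coset_point_inj.
by rewrite invg1 mul1g.
Qed.

(** Two reflections whose product has finite order belong to linked pairs, and
the two kinds of links are the two alternatives. *)
Lemma finite_order_conjugate r t u : J r -> J t ->
    r <> iota u * t * (iota u)^-1 ->
    finite_order (r * (iota u * t * (iota u)^-1)) ->
  (t <> r /\ finite_order (r * t) /\ exists2 a, P r a &
     iota u * t * (iota u)^-1 = iota a * t * (iota a)^-1) \/
  (exists a v, [/\ P r a, I v, exists2 n, (2 < n)%N & has_order (r * iota v) n &
     iota u * t * (iota u)^-1 = iota a * iota v * r * iota v * (iota a)^-1]).
Proof.
have [Phi [PhiJ PhiI]] := reflection_representation.
move=> Jr Jt; set s := iota u * t * _ => neq_rs [n [n0 rsn _]].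
set x := coset_point r 1; set y := coset_point t u.
have Phi_rs : Phi (r * s) = sym_reflection x * sym_reflection y.
  by rewrite !gmulfM homV !PhiI !PhiJ // act_reflection translate_coset mulg1.
have neq_xy : x <> y.
  move=> /coset_point_inj; rewrite invg1 mul1g => -[rt /perp_commute ur].
  by apply: neq_rs; rewrite /s -rt ur mulgK.
have M0 : cox_matrix x y <> 0%N.
  move=> M0; have [h] := reflection_order_inf cox_matrixxx cox_matrixC M0 n0.
  apply; rewrite -[RHS](_ : (Phi (r * s) ^+ n) h = h); last first.
    by rewrite -homX rsn hom1.
  by rewrite Phi_rs sym_expE.
have [a [b [xa yb link ord]]] : linked_order x y (cox_matrix x y).
  move: M0; rewrite /cox_matrix asboolF //.
  by case: xgetP => // m _.
have m0 : (0 < cox_matrix x y)%N by rewrite lt0n; apply/eqP.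
have Pa : P r a by move: xa; rewrite /= invg1 mul1g.
have ra := perp_commute Pa.
have conj_b : s = iota b * t * (iota b)^-1 by rewrite (conj_coset yb).
have conj_r : iota a * r * (iota a)^-1 = r by rewrite ra mulgK.
move: link ord; rewrite /=; case: eqP => [rt Iab|neq_rt eq_ab] ord.
  right; exists a, (a^-1 * b); have v2 := I2 Iab.
  set v := a^-1 * b in Iab v2 *.
  have sE : s = iota a * iota v * r * iota v * (iota a)^-1.
    rewrite conj_b -rt -[b](mulVKg a) -/v gmulfM invgM.
    by rewrite -(homV iota v) (invg_order2 v2) !mulgA.
  split=> //.
  have [m ordm] : finite_order (r * iota v).
    apply: (@ex_has_order _ _ (2 * cox_matrix x y)); first by rewrite muln_gt0.
    rewrite expgnA expg2.
    have : has_order (r * s) (cox_matrix x y).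
      by move: ord; rewrite conj_r -conj_b.
    rewrite sE -{1}conj_r.
    rewrite -(_ : iota a * (r * iota v * (r * iota v)) * (iota a)^-1 =
      iota a * r * (iota a)^-1 * (iota a * iota v * r * iota v * (iota a)^-1)).
      by case/has_order_conj.
    by rewrite !mulgA mulgVK.
  exists m => //.
  (* r commutes with a; if r v had order at most 2, r would also commute
     with v, and s would be r *)
  rewrite ltnNge; apply/negP => m2.
  have rv2 : (r * iota v) ^+ 2 = 1.
    case: ordm; case: (m) m2 => [|[|[]]] // _ _.
    by rewrite expg1 => ->; rewrite expg1n.
  have rv : iota v * r = r * iota v.
    move/mulg1_eq: rv2; rewrite invgM -(homV iota v) (invg_order2 v2).
    by rewrite (invg_order2 (order2J Jr)).
  apply: neq_rs; rewrite sE -[_ * r]mulgA rv -!mulgA (mulgA (iota v)) -gmulfM.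
  by rewrite mulg_order2 // hom1 mul1g mulgA.
left; split; first by move/esym.
split; last by exists a; rewrite // eq_ab.
exists (cox_matrix x y); move: ord; rewrite -eq_ab -conj_mulg.
by move/has_order_conj.
Qed.

End ReflectionRepresentation.

(** * Extending morphisms from the generators of a semidirect product *)

Section SemidirectCoxeter.
Variables (Wp Wt : groupType) (I : set Wp) (Jt : set Wt).
Hypotheses (coxI : coxeter_system I) (coxJt : coxeter_system Jt).
Variable theta : {multiplicative Wp -> coxeter_aut Jt}.
Variable J : set Wt.
Hypothesis repJ : orbit_representatives theta J.
Local Notation W := (sdprod theta).
Local Notation iota := (sdr theta).
Local Notation iotat := (sdl theta).
Local Notation S := (iota @` I `|` iotat @` J).
Local Notation P r := (gen_subgroup (I `&` iota @^-1` perp S (iotat r))).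
Implicit Types (r s t x : Wt) (u v p : Wp).

Lemma sdr_inj : injective iota. Proof. by move=> u v []. Qed.
Lemma sdl_inj : injective iotat. Proof. by move=> x y []. Qed.

Lemma theta_gens u s : Jt s -> Jt (theta u s).
Proof.
move=> Js; have : (theta u @` Jt) (theta u s) by exists s.
by rewrite coxeter_aut_gens.
Qed.

Lemma thetaK u : cancel (theta u) (theta u^-1).
Proof. by move=> x; rewrite -thetaM mulVg theta1. Qed.

Lemma orbit_decomposition s : Jt s -> exists r u, J r /\ s = theta u r.
Proof.
move=> /(proj2 repJ)[r [[Jr [u us]] _]]; exists r, u^-1; split=> //.
by rewrite -us thetaK.
Qed.

Lemma sub_repJ r : J r -> Jt r. Proof. exact: (proj1 repJ). Qed.

Lemma sdprod_order2 a : S a -> has_order a 2.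
Proof.
case: coxI => oI _ _; case: coxJt => oJ _ _.
by case=> -[x Xx <-]; apply/has_order_morph => //;
  [exact: sdr_inj|exact: oI|exact: sdl_inj|exact/oJ/sub_repJ].
Qed.

Lemma sdprod_gen : gen_subgroup S = [set: W].
Proof.
have genr u : gen_subgroup S (iota u).
  have: gen_subgroup I u by case: coxI => _ -> _.
  move: u; apply: gen_subgroup_ind => [|u v Su Sv|v Iv].
  - exact: gen_subgroup1.
  - by rewrite gmulfM homV; apply: gen_subgroupM => //; apply: gen_subgroupV.
  - by apply: sub_gen_subgroup; left; exists v.
have genl x : gen_subgroup S (iotat x).
  have: gen_subgroup Jt x by case: coxJt => _ -> _.
  move: x; apply: gen_subgroup_ind => [|u v Su Sv|s /orbit_decomposition].
  - exact: gen_subgroup1.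
  - by rewrite gmulfM homV; apply: gen_subgroupM => //; apply: gen_subgroupV.
  - case=> r [u [Jr ->]]; rewrite -sdprod_conj.
    apply: gen_subgroupM; last exact: gen_subgroupV.
    by apply: gen_subgroupM => //; apply: sub_gen_subgroup; right; exists r.
apply/seteqP; split=> // a _.
by rewrite (sdprodE a); apply: gen_subgroupM.
Qed.

Section UniversalProperty.
Hypothesis fixer : forall r s u, J r -> J s ->
  iotat r = iota u * iotat s * (iota u)^-1 -> r = s /\ P r u.
Hypothesis finite_pairs :
  forall r s : Wt, J r -> Jt s -> r <> s -> finite_order (r * s) ->
     (exists (u : Wp) (t : Wt),
        [/\ P r u, J t, t <> r, finite_order (r * t) &
            iotat s = iota u * iotat t * (iota u)^-1]) \/
     (exists (u v : Wp),
        [/\ P r u, I v,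
            exists2 n, (2 < n)%N & has_order (iotat r * iota v) n &
            iotat s =
              iota u * iota v * iotat r * iota v * (iota u)^-1]).

Variables (H : groupType) (f : W -> H).
Hypothesis frel : forall (s t : W) (n : nat),
  S s -> S t -> has_order (s * t) n -> (f s * f t) ^+ n = 1.

Lemma frel_sqr (a : W) : S a -> f a * f a = 1.
Proof.
move=> Sa; apply: (frel (n := 1)) => //.
exact/has_order1/mulg_order2/sdprod_order2.
Qed.

Lemma SI v : I v -> S (iota v). Proof. by move=> Iv; left; exists v. Qed.
Lemma SJ r : J r -> S (iotat r). Proof. by move=> Jr; right; exists r. Qed.

Lemma extend_Wp : exists phi : {multiplicative Wp -> H},
  forall v, I v -> phi v = f (iota v).
Proof.
case: coxI => _ _ /(_ H (f \o iota)); apply=> s t n Is It ord.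
apply: frel; [exact: SI|exact: SI|].
by rewrite -gmulfM; apply/has_order_morph => //; exact: sdr_inj.
Qed.

Variable phi : {multiplicative Wp -> H}.
Hypothesis phiI : forall v, I v -> phi v = f (iota v).

(** A generator v of P r commutes with r, so r v has order 2, and the
corresponding relation says that the images commute. *)
Lemma phi_commute r p : J r -> P r p ->
  phi p * f (iotat r) = f (iotat r) * phi p.
Proof.
move=> Jr; move: p; apply: gen_subgroup_ind => [|p q cp cq|v [Iv [_ /= rv]]].
- by rewrite hom1 mul1g mulg1.
- rewrite gmulfM homV.
  exact: (commute_sym (commuteM (commute_sym cp) (commuteV (commute_sym cq)))).
have [r2 v2] := (sdprod_order2 (SJ Jr), sdprod_order2 (SI Iv)).
have fV a : S a -> (f a)^-1 = f a by move/frel_sqr/mulg1_eq.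
have rel : (f (iotat r) * f (iota v)) ^+ 2 = 1.
  apply: frel; [exact: SJ|exact: SI|split=> //].
    by rewrite expgMn // !expg2 (mulg_order2 r2) (mulg_order2 v2) mulg1.
  case=> [|[|m]] // _; rewrite expg1 => /(congr1 snd) /= /eqP.
  by rewrite mul1g => /eqP v1; case: coxI => /(_ v Iv)/neq1_order2.
by rewrite phiI //; move/mulg1_eq: rel; rewrite invgM !fV //;
  [exact: SJ|exact: SI].
Qed.

(** Two conjugates u r u^-1 and u' r' u'^-1 are equal only if r = r' and u' lies
in u P r; the proposed values then agree, by phi_commute. *)
Lemma extend_Jt : exists g : Wt -> H, forall r u, J r ->
  g (theta u r) = phi u * f (iotat r) * (phi u)^-1.
Proof.
have [s|g gP] := @choice Wt H (fun s h => forall r u, J r -> s = theta u r ->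
    h = phi u * f (iotat r) * (phi u)^-1).
  have [[r [u [Jr ->]]]|no] := pselect (exists r u, J r /\ s = theta u r);
    last by exists 1 => r u Jr sE; case: no; exists r, u.
  exists (phi u * f (iotat r) * (phi u)^-1) => r' u' Jr' eq_s.
  have [rr' Pu] : r = r' /\ P r (u^-1 * u').
    by apply: fixer => //; rewrite sdprod_conj thetaM -eq_s thetaK.
  subst r'; rewrite -[u'](mulVKg u) gmulfM -[_ * f _ in RHS]mulgA.
  by rewrite (phi_commute Jr Pu) invgM !mulgA mulgK.
by exists g => r u Jr; apply: gP.
Qed.

Variable g : Wt -> H.
Hypothesis gJ : forall r u, J r ->
  g (theta u r) = phi u * f (iotat r) * (phi u)^-1.

Lemma g_equivariant u s : Jt s -> g (theta u s) = phi u * g s * (phi u)^-1.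
Proof.
move=> /orbit_decomposition[r [v [Jr ->]]].
by rewrite -thetaM !gJ // gmulfM invgM !mulgA.
Qed.

Lemma g_rep r : J r -> g r = f (iotat r).
Proof.
by move=> Jr; rewrite -{1}[r](theta1 theta) gJ // hom1 mul1g invg1 mulg1.
Qed.

(** In both cases of (2), u fixes r, so conjugation by u reduces the relation to
one between r and t, or to one on (r v)^2. *)
Lemma g_relation_rep r s n : J r -> Jt s -> has_order (r * s) n ->
  (g r * g s) ^+ n = 1.
Proof.
move=> Jr Js ord; rewrite g_rep //.
have [<-|neq_rs] := pselect (r = s).
  by rewrite g_rep // frel_sqr ?expg1n //; exact: SJ.
have fin : finite_order (r * s) by exists n.
have ord_l : has_order (iotat r * iotat s) n.
  by rewrite -gmulfM; apply/has_order_morph => //; exact: sdl_inj.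
have fixW u : P r u -> iotat r = iota u * iotat r * (iota u)^-1.
  by move=> Pu; rewrite (perp_commute Pu) mulgK.
have fixH u : P r u -> f (iotat r) = phi u * f (iotat r) * (phi u)^-1.
  by move=> Pu; rewrite (phi_commute Jr Pu) mulgK.
case: (finite_pairs Jr Js neq_rs fin) => [[u [t [Pu Jt' _ _ sE]]]|].
  have gs : g s = phi u * f (iotat t) * (phi u)^-1.
    by rewrite -gJ //; congr g; apply: sdl_inj; rewrite sE sdprod_conj.
  rewrite gs (fixH _ Pu) -conj_mulg -conj_expg.
  rewrite frel ?mulg1 ?mulgV //; try exact: SJ.
  by move: ord_l; rewrite sE {1}(fixW _ Pu) -conj_mulg => /has_order_conj.
case=> u [v [Pu Iv [m _ ordm] sE]].
have square (G : groupType) (a b c : G) :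
    a * b * a^-1 * (a * c * b * c * a^-1) = a * (b * c) ^+ 2 * a^-1.
  by rewrite expg2 !mulgA mulgVK.
have v2 : has_order v 2 by case: coxI => + _ _; apply.
have gs : g s = phi u * f (iota v) * f (iotat r) * f (iota v) * (phi u)^-1.
  have -> : s = theta (u * v) r.
    apply: sdl_inj; rewrite sE -sdprod_conj gmulfM invgM -(homV iota v).
    by rewrite (invg_order2 v2) !mulgA.
  by rewrite gJ // gmulfM invgM -(homV phi v) (invg_order2 v2) (phiI Iv) !mulgA.
rewrite gs {1}(fixH _ Pu) square -conj_expg -expgnA.
(* the order m of r v divides 2 n, where n is the order of r s *)
rewrite (@expg_dvdn _ _ m) ?mulg1 ?mulgV //.
  by apply: frel => //; [exact: SJ|exact: SI].
apply: has_order_dvdn ordm _; rewrite expgnA.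
by move: ord_l; rewrite sE {1}(fixW _ Pu) square => /has_order_conj[].
Qed.

Lemma extend_Wt : exists psi : {multiplicative Wt -> H},
  forall s, Jt s -> psi s = g s.
Proof.
case: coxJt => _ _; apply=> s t n Js Jt' ord.
have [r [u [Jr sE]]] := orbit_decomposition Js.
have tE : t = theta u (theta u^-1 t) by rewrite -{1}[u]invgK thetaK.
have Ju : Jt (theta u^-1 t) by exact: theta_gens.
rewrite sE tE (g_equivariant u (sub_repJ Jr)) (g_equivariant u Ju).
rewrite -conj_mulg -conj_expg g_relation_rep ?mulg1 ?mulgV //.
move: ord; rewrite sE {1}tE -coxeter_autM.
pose th : {multiplicative Wt -> Wt} := HB.pack (theta u : Wt -> Wt)
  (isMultiplicative.Build _ _ _ (coxeter_autM (theta u))).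
move/(has_order_morph (f := th)); apply; exact: can_inj (thetaK u).
Qed.

Variable psi : {multiplicative Wt -> H}.
Hypothesis psiJ : forall s, Jt s -> psi s = g s.

Lemma psi_equivariant u x : psi (theta u x) = phi u * psi x * (phi u)^-1.
Proof.
have: gen_subgroup Jt x by case: coxJt => _ -> _.
apply: (eq_on_gen (f := psi \o theta u)
                  (g := fun x => phi u * psi x * (phi u)^-1)).
- by move=> y z /=; rewrite coxeter_autM gmulfM.
- by move=> y z /=; rewrite gmulfM conj_mulg.
by move=> s Js /=; rewrite !psiJ ?g_equivariant //; exact: theta_gens.
Qed.

Lemma extend_W : exists Phi : {multiplicative W -> H},
  forall a, S a -> Phi a = f a.
Proof.
pose F (a : W) : H := psi a.1 * phi a.2.
have FM : {morph F : a b / a * b}.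
  move=> a b; rewrite /F /= !gmulfM psi_equivariant.
  by rewrite -!mulgA (mulgA _^-1) mulVg mul1g.
pose Phi : {multiplicative W -> H} :=
  HB.pack F (isMultiplicative.Build _ _ F FM).
exists Phi => _ [[v Iv <-]|[r Jr <-]].
  by rewrite /= /F /= hom1 mul1g phiI.
by rewrite /= /F /= hom1 mulg1 psiJ ?g_rep //; exact: sub_repJ.
Qed.

End UniversalProperty.

End SemidirectCoxeter.

(** * The criterion *)

Theorem theorem2p1 (Wp Wt : groupType) (I : set Wp) (Jt : set Wt)
    (coxI : coxeter_system I) (coxJt : coxeter_system Jt)
    (theta : {multiplicative Wp -> coxeter_aut Jt})
    (J : set Wt) (repJ : orbit_representatives theta J) :
  let W : groupType := sdprod theta in
  let iota : Wp -> W := sdr theta in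
  let iotat : Wt -> W := sdl theta in
  let S : set W := iota @` I `|` iotat @` J in
  (* the standard parabolic subgroup of Wp generated by I `&` r^perp *)
  let P (r : Wt) : set Wp :=
    gen_subgroup (I `&` iota @^-1` perp S (iotat r)) in
  coxeter_system S <->
  (forall (r s : Wt) (u : Wp), J r -> J s ->
     iotat r = iota u * iotat s * (iota u)^-1 ->
     r = s /\ P r u) /\
  (forall r s : Wt, J r -> Jt s -> r <> s -> finite_order (r * s) ->
     (exists (u : Wp) (t : Wt),
        [/\ P r u, J t, t <> r, finite_order (r * t) &
            iotat s = iota u * iotat t * (iota u)^-1]) \/
     (exists (u v : Wp),
        [/\ P r u, I v,
            exists2 n, (2 < n)%N & has_order (iotat r * iota v) n &
            iotat s =
              iota u * iota v * iotat r * iota v * (iota u)^-1])).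
Proof.
move=> W iota iotat S P; split; last first.
  case=> fixer finite_pairs; split.
  - exact: sdprod_order2.
  - exact: sdprod_gen.
  move=> H f frel.
  have [phi phiI] := extend_Wp coxI frel.
  have [g gJ] := extend_Jt coxI coxJt repJ fixer frel phiI.
  have [psi psiJ] := extend_Wt coxI coxJt repJ finite_pairs frel phiI gJ.
  by have [Phi PhiS] := extend_W coxJt repJ phiI gJ psiJ; exists Phi.
move=> coxS.
have prM : {morph (fun a : W => a.2) : a b / a * b} by [].
pose pr : {multiplicative W -> Wp} :=
  HB.pack (fun a : W => a.2) (isMultiplicative.Build _ _ _ prM).
have iotaK : cancel iota pr by [].
have prJ r : (iotat @` J) r -> pr r = 1 by case=> s _ <-.
have SJ r : J r -> (iotat @` J) (iotat r) by exists r.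
have fin_l x y : finite_order (iotat x * iotat y) <-> finite_order (x * y).
  by split=> -[n ord]; exists n; move: ord; rewrite -gmulfM;
    move/(has_order_morph _ _ (@sdl_inj _ _ _ theta)).
split=> [r s u Jr Js rE|r s Jr Jts neq_rs fin].
  have [/(@sdl_inj _ _ _ theta) rs Pu] :=
    conjugate_in_J iotaK prJ coxI coxS (SJ _ Jr) (SJ _ Js) rE.
  by split.
have [t [u [Jt' sE]]] := orbit_decomposition repJ Jts.
have siE : iotat s = iota u * iotat t * (iota u)^-1 by rewrite sdprod_conj sE.
have :=
  finite_order_conjugate iotaK prJ coxI coxS (u := u) (SJ _ Jr) (SJ _ Jt').
rewrite -siE; case=> [/(@sdl_inj _ _ _ theta)//||[neq_tr [fin_rt [a Pa sa]]]|].
- exact/fin_l.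
- left; exists a, t; split=> //; last exact/fin_l.
  by move=> tr; apply: neq_tr; rewrite tr.
by right.
Qed.
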